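(* Let $(X,x)$ be a pointed topological space, let $\mathbf{p}:(X,x)\to(\mathbf{X},\mathbf{x})=((X_\lambda,x_\lambda),p_{\lambda\lambda'},\Lambda)$ be an HPol$_*$-expansion of $(X,x)$, and let $k\in\mathbb{N}$. Consider $J:\check{\pi}_k^{top}(X,x)\to\check{\pi}_k^{*^{top}}(X,x)$ given by $J(F)=F^*$, where for $F=\langle(f,f_\lambda)\rangle$ one puts $F^*=\langle(f,f^n_\lambda)\rangle$ with $f^n_\lambda=f_\lambda$ for all $n\in\mathbb{N}$ and $\lambda\in\Lambda$. Then $J$ is a topological embedding.
   Context: HTop$_*$ is the homotopy category of pointed topological spaces (pointed homotopy classes of pointed maps), HPol$_*$ its full subcategory of pointed spaces having the homotopy type of pointed polyhedra. Inverse systems are indexed by directed sets. Pro$^*$-category. For inverse systems $\mathbf{X}=(X_\lambda,p_{\lambda\lambda'},\Lambda)$, $\mathbf{Y}=(Y_\mu,q_{\mu\mu'},M)$ in a category $\mathcal{T}$, an $S^*$-morphism $(f,f^n_\mu):\mathbf{X}\to\mathbf{Y}$ consists of a function $f:M\to\Lambda$ and $\mathcal{T}$-morphisms $f^n_\mu:X_{f(\mu)}\to Y_\mu$ ($n\in\mathbb{N},\mu\in M$) such that for all $\mu\le\mu'$ there are $\lambda\ge f(\mu),f(\mu')$ and $n\in\mathbb{N}$ with $q_{\mu\mu'}f^{n'}_{\mu'}p_{f(\mu')\lambda}=f^{n'}_\mu p_{f(\mu)\lambda}$ for all $n'\ge n$. Two such, $(f,f^n_\mu)$ and $(f',f'^n_\mu)$,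 are equivalent if for each $\mu\in M$ there are $\lambda\ge f(\mu),f'(\mu)$ and $n\in\mathbb{N}$ with $f^{n'}_\mu p_{f(\mu)\lambda}=f'^{n'}_\mu p_{f'(\mu)\lambda}$ for all $n'\ge n$. Composition: $(g,g^n_\nu)(f,f^n_\mu)=(fg,\,g^n_\nu f^n_{g(\nu)})$. Pro$^*$-$\mathcal{T}$ has inverse systems as objects and equivalence classes $[(f,f^n_\mu)]$ as morphisms; pro-$\mathcal{T}$ is regarded as a subcategory by $f^n_\mu=f_\mu$ for all $n$. Expansions. An HPol$_*$-expansion of $(X,x)$ is a morphism $\mathbf{p}=(p_\lambda):(X,x)\to(\mathbf{X},\mathbf{x})=((X_\lambda,x_\lambda),p_{\lambda\lambda'},\Lambda)$ in pro-HTop$_*$ with all $(X_\lambda,x_\lambda)$ in HPol$_*$ such that (E1) each morphism $h:(X,x)\to P$ of HTop$_*$ with $P$ in HPol$_*$ factors as $h=fp_\lambda$ for some $\lambda$ and $f:(X_\lambda,x_\lambda)\to P$; (E2) if $f_0,f_1:(X_\lambda,x_\lambda)\to P$, $P$ in HPol$_*$, satisfy $f_0p_\lambda=f_1p_\lambda$, then $f_0p_{\lambda\lambda'}=f_1p_{\lambda\lambda'}$ for some $\lambda'\ge\lambda$. Every pointed space has an HPol$_*$-expansion, unique up to a unique compatible isomorphism in pro-HPol$_*$. Pointed (coarse) shape category. Objects: pointed spaces. A coarse shape morphism $F^*:(X,x)\to(Y,y)$ is a class $\langle\mathbf{f}^*\rangle$ of pro$^*$-HPol$_*$ morphisms between HPol$_*$-expansions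 of $(X,x)$ and $(Y,y)$, morphisms for different expansions being identified when they correspond under the canonical isomorphisms; a shape morphism $F=\langle\mathbf{f}\rangle$ is defined in the same way using pro-HPol$_*$. Composition is by representatives; $Sh^*((X,x),(Y,y))$ and $Sh((X,x),(Y,y))$ are the sets of coarse shape and shape morphisms. Morphisms of HTop$_*$ (e.g. $p_\lambda$) induce (coarse) shape morphisms, written with the same symbol in compositions. Topologies and groups. Let $\mathbf{p}$ be an HPol$_*$-expansion of $(X,x)$. $Sh^*((Y,y),(X,x))$ carries the topology with basis $V^{F^*}_\lambda=\{G^*:p_\lambda\circ F^*=p_\lambda\circ G^*\}$, and $Sh((Y,y),(X,x))$ the topology with basis $V^{F}_\lambda=\{G:p_\lambda\circ F=p_\lambda\circ G\}$ ($\lambda\in\Lambda$, $F^*$, $F$ arbitrary); these are independent of $\mathbf{p}$. $\check\pi_k^{*^{top}}(X,x)$ is $Sh^*((S^k,* ),(X,x))$ and $\check\pi_k^{top}(X,x)$ (the topological shape homotopy group) is $Sh((S^k,* ),(X,x))$, with these topologies and the group operations induced levelwise by those of $\pi_k(X_\lambda,x_\lambda)$ on representatives $f^n_\lambda$, respectively $f_\lambda$, $:(S^k,* )\to(X_\lambda,x_\lambda)$. *)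

(* Defs.v *)
From HB Require Import structures.
From mathcomp Require Import all_boot all_order all_algebra.
From mathcomp Require Import all_classical all_reals all_analysis.

Set Implicit Arguments.
Unset Strict Implicit.
Unset Printing Implicit Defensive.

Import Order.TTheory GRing.Theory Num.Theory.
Import numFieldNormedType.Exports.

Local Open Scope classical_set_scope.
Local Open Scope ring_scope.

Section Quotient.
Variables (A : Type) (E : A -> A -> Prop).

Record equivalence_prop : Prop := EquivalenceProp {
  eqv_refl : forall a, E a a;
  eqv_sym : forall a b, E a b -> E b a;
  eqv_trans : forall a b c, E a b -> E b c -> E a c }.

(* The quotients below are taken on types that are too large for the          *)
(* [choiceType]s of [generic_quotient] and for [classical_sets.set].          *)
Definition quot : Type := {C : A -> Prop | exists a, C = E a}.

Definition eq_class (a : A) : quot := exist _ (E a) (ex_intro _ a erefl).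

Definition representative (c : quot) : A := projT1 (cid (proj2_sig c)).

Lemma representativeK c : eq_class (representative c) = c.
Proof.
case: c => C exC; apply: eq_exist; rewrite /representative /=.
by case: cid => a /= ->.
Qed.

Lemma eq_classI c : exists a, c = eq_class a.
Proof. by exists (representative c); rewrite representativeK. Qed.

Hypothesis eqE : equivalence_prop.

Lemma eq_classP a b : eq_class a = eq_class b <-> E a b.
Proof.
split=> [/(congr1 (@proj1_sig _ _)) /= Eab|Eab].
  by rewrite Eab; apply: eqv_refl.
apply: eq_exist; apply/funext => c; apply/propext; split => Ec.
  by apply: (eqv_trans eqE) Ec; apply: eqv_sym.
exact: (eqv_trans eqE) Eab Ec.
Qed.

Lemma representativeP a : E (representative (eq_class a)) a.
Proof. by apply/eq_classP; rewrite representativeK. Qed.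

End Quotient.

Record category (O : Type) := Category {
  hom :> O -> O -> Type;
  idm : forall X, hom X X;
  ccomp : forall X Y Z, hom Y Z -> hom X Y -> hom X Z;
  comp_assoc : forall X Y Z W (h : hom Z W) (g : hom Y Z) (f : hom X Y),
    ccomp h (ccomp g f) = ccomp (ccomp h g) f;
  comp_idl : forall X Y (f : hom X Y), ccomp (idm Y) f = f;
  comp_idr : forall X Y (f : hom X Y), ccomp f (idm X) = f }.

Arguments idm {O} c X.
Arguments ccomp {O c X Y Z}.
Notation "g \oc f" := (ccomp g f) (at level 50, left associativity).

Definition is_iso (O : Type) (C : category O) X Y (f : C X Y) :=
  exists g : C Y X, g \oc f = idm C X /\ f \oc g = idm C Y.

Record io_functor (O : Type) (A B : category O) := IOFunctor {
  fmap :> forall X Y, A X Y -> B X Y;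
  fmap_id : forall X, fmap (idm A X) = idm B X;
  fmap_comp : forall X Y Z (g : A Y Z) (f : A X Y),
    fmap (g \oc f) = fmap g \oc fmap f }.

Arguments fmap {O A B} i {X Y}.

Definition id_functor (O : Type) (A : category O) : io_functor A A :=
  @IOFunctor O A A (fun _ _ => id) (fun=> erefl) (fun _ _ _ _ _ => erefl).

Section PointedHomotopy.
Variable R : realType.

Record pmap (X Y : ptopologicalType) := PMap {
  pmap_fun :> X -> Y;
  pmap_continuous : continuous pmap_fun;
  pmap_point : pmap_fun point = point }.

Definition pmap_id X : pmap X X :=
  @PMap X X id (fun x => @cvg_id _ (nbhs x)) erefl.

Lemma pmap_comp_continuous X Y Z (g : pmap Y Z) (f : pmap X Y) :
  continuous (g \o f).
Proof.
move=> x; apply: continuous_comp; exact: pmap_continuous.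
Qed.

Lemma pmap_comp_point X Y Z (g : pmap Y Z) (f : pmap X Y) :
  (g \o f) point = point.
Proof. by rewrite /= !pmap_point. Qed.

Definition pmap_comp X Y Z (g : pmap Y Z) (f : pmap X Y) : pmap X Z :=
  PMap (@pmap_comp_continuous _ _ _ g f) (pmap_comp_point g f).

Definition phomotopic (X Y : ptopologicalType) (f g : pmap X Y) :=
  exists H : X * R -> Y,
    [/\ {within [set: X] `*` `[0, 1]%classic, continuous H},
        forall x, H (x, 0) = f x,
        forall x, H (x, 1) = g x &
        forall t, 0 <= t <= 1 -> H (point, t) = point].

Lemma pair_continuous (S T U : topologicalType) (f : S -> T) (g : S -> U) :
  continuous f -> continuous g -> continuous (fun z => (f z, g z)).
Proof.
move=> cf cg z.
exact: (@cvg_pair _ _ _ (nbhs z) (nbhs (f z)) (nbhs (g z)) _ _ _ f g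
  (cf z) (cg z)).
Qed.

Lemma fst_continuous (S T : topologicalType) : continuous (@fst S T).
Proof. by move=> z; exact: cvg_fst. Qed.

Lemma snd_continuous (S T : topologicalType) : continuous (@snd S T).
Proof. by move=> z; exact: cvg_snd. Qed.

Let clamp (t : R) := Num.max 0 (Num.min t 1).

Lemma clamp_continuous : continuous clamp.
Proof.
move=> t; apply: (@continuous_max R R (fun=> 0) (fun t => Num.min t 1)).
  exact: cvg_cst.
apply: (@continuous_min R R id (fun=> 1)); [exact: cvg_id|exact: cvg_cst].
Qed.

Lemma phomotopicP (X Y : ptopologicalType) (f g : pmap X Y) :
  phomotopic f g <-> exists H : X * R -> Y,
    [/\ continuous H, forall x t, t <= 0 -> H (x, t) = f x,
        forall x t, 1 <= t -> H (x, t) = g x &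
        forall t, H (point, t) = point].
Proof.
split=> [[H [cH H0 H1 Hpt]]|[H [cH H0 H1 Hpt]]]; last first.
  exists H; split=> [|x|x|t _]; [|exact: H0|exact: H1|exact: Hpt].
  exact: continuous_subspaceT.
have clamp01 t : 0 <= clamp t <= 1.
  by rewrite /clamp le_max lexx /= ge_max ler01 ge_min lexx orbT.
exists (fun z => H (z.1, clamp z.2)); split=> [z|x t t0|x t t1|t]; last 3 first.
- by rewrite /clamp min_l ?max_l ?H0 // (le_trans t0).
- by rewrite /clamp min_r // max_r // H1.
- exact: Hpt.
move: cH => /subspace_continuousP /(_ (z.1, clamp z.2)).
have Az : ([set: X] `*` `[0, 1]%classic) (z.1, clamp z.2).
  by split=> //=; rewrite in_itv /= clamp01.
move=> /(_ Az) cH U nU; have {nU} := cH U nU; rewrite /= /within /= => nU.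
have c2 : continuous (fun w : X * R => (w.1, clamp w.2)).
  apply: pair_continuous; first exact: fst_continuous.
  by move=> w; apply: (@continuous_comp _ _ _ snd clamp);
    [exact: cvg_snd|exact: clamp_continuous].
have n2 : nbhs z [set w | ([set: X] `*` `[0, 1]%classic) (w.1, clamp w.2) ->
    U (H (w.1, clamp w.2))] by exact: (c2 z _ nU).
apply: (@filterS _ (nbhs z) _ _ _ _ n2) => w /=; apply.
by split=> //=; rewrite in_itv /= clamp01.
Qed.

Lemma phomotopic_eq (X Y : ptopologicalType) (f g : pmap X Y) :
  f =1 g -> phomotopic f g.
Proof.
move=> fg; apply/phomotopicP; exists (fun z => f z.1); split=> // [z|t].
  apply: (@continuous_comp _ _ _ fst f); first exact: cvg_fst.
  exact: pmap_continuous.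
exact: pmap_point.
Qed.

Lemma phomotopic_equivalence X Y : equivalence_prop (@phomotopic X Y).
Proof.
split=> [f|f g|f g h]; first exact: phomotopic_eq.
  move=> /phomotopicP [H [cH H0 H1 Hpt]]; apply/phomotopicP.
  exists (fun z => H (z.1, 1 - z.2)); split=> // [z|x t t0|x t t1].
  - apply: (@continuous_comp _ _ _ (fun z : X * R => (z.1, 1 - z.2)) H).
      apply: pair_continuous z; first exact: fst_continuous.
      by move=> z; apply: cvgB; [exact: cvg_cst|exact: cvg_snd].
    exact: cH.
  - by rewrite /= H1 // lerBrDr gerDl.
  - by rewrite /= H0 // subr_le0.
move=> /phomotopicP [H [cH H0 H1 Hpt]] /phomotopicP [K [cK K0 K1 Kpt]].
apply/phomotopicP; pose h2 : R := 2^-1.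
have h20 : 0 < h2 by rewrite invr_gt0.
have h2D : h2 + h2 = 1 by rewrite [RHS]splitr mul1r.
exists (fun z => if z.2 <= h2 then H (z.1, z.2 + z.2)
                 else K (z.1, z.2 + z.2 - 1)).
split=> [|x t t0|x t t1|t] /=; last 3 first.
- by rewrite (le_trans t0 (ltW h20)) H0 // -[0]addr0 lerD.
- have t2 : 1 <= t + t - 1 by rewrite lerBrDr lerD.
  case: ifP => [th|_]; last exact: K1.
  have := lt_le_trans (lt_le_trans _ t1) th; have : h2 < 1.
    by rewrite -h2D ltrDl.
  by move=> a /(_ h2 a); rewrite ltxx.
- by case: ifP.
pose G (z : X * R) := if z.2 <= h2 then H (z.1, z.2 + z.2)
                 else K (z.1, z.2 + z.2 - 1).
pose A : set (X * R) := snd @^-1` [set t | t <= h2].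
pose B : set (X * R) := snd @^-1` [set t | h2 <= t].
have clA : closed A by apply: preimage_closed => [z _|]; [exact: snd_continuous|exact: closed_le].
have clB : closed B by apply: preimage_closed => [z _|]; [exact: snd_continuous|exact: closed_ge].
rewrite -/G; apply/continuous_subspace_setT.
have -> : [set: X * R] = A `|` B.
  apply/seteqP; split=> // z _; rewrite /A /B /=.
  by case: (leP z.2 h2) => [|/ltW]; [left|right].
have cD : continuous (fun z : X * R => (z.1, z.2 + z.2)).
  apply: pair_continuous; first exact: fst_continuous.
  by move=> z; apply: cvgD; exact: cvg_snd.
have cE : continuous (fun z : X * R => (z.1, z.2 + z.2 - 1)).
  apply: pair_continuous; first exact: fst_continuous.
  by move=> z; apply: cvgB; [apply: cvgD; exact: cvg_snd|exact: cvg_cst].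
apply: withinU_continuous => //.
  apply: (@subspace_eq_continuous _ A _ (fun z => H (z.1, z.2 + z.2))).
    by move=> z; rewrite inE => Az; rewrite /from_subspace /G /= ifT.
  apply: continuous_subspaceT => z.
  by apply: (@continuous_comp _ _ _ (fun z : X * R => (z.1, z.2 + z.2)) H);
    [exact: cD|exact: cH].
apply: (@subspace_eq_continuous _ B _ (fun z => K (z.1, z.2 + z.2 - 1))).
  move=> z; rewrite inE => hz; rewrite /from_subspace /G /=; case: ifP => // zh.
  have -> : z.2 = h2 by apply/eqP; rewrite eq_le zh /=; exact: hz.
  by rewrite h2D subrr H1 // K0.
apply: continuous_subspaceT => z.
by apply: (@continuous_comp _ _ _ (fun z : X * R => (z.1, z.2 + z.2 - 1)) K);
  [exact: cE|exact: cK].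
Qed.

Lemma phomotopic_comp X Y Z (g g' : pmap Y Z) (f f' : pmap X Y) :
  phomotopic g g' -> phomotopic f f' ->
  phomotopic (pmap_comp g f) (pmap_comp g' f').
Proof.
move=> /phomotopicP [K [cK K0 K1 Kpt]] /phomotopicP [H [cH H0 H1 Hpt]].
apply/phomotopicP; exists (fun z => K (H z, z.2)).
split=> [z|x t t0|x t t1|t]; last 3 first.
- by rewrite H0 // K0.
- by rewrite H1 // K1.
- by rewrite Hpt.
apply: (@continuous_comp _ _ _ (fun z : X * R => (H z, z.2)) K).
  by apply: pair_continuous; [exact: cH|exact: snd_continuous].
exact: cK.
Qed.

Definition htop_hom X Y : Type := quot (@phomotopic X Y).

Definition htop_class X Y (f : pmap X Y) : htop_hom X Y :=
  eq_class (@phomotopic X Y) f.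

Definition htop_comp X Y Z (g : htop_hom Y Z) (f : htop_hom X Y) :=
  htop_class (pmap_comp (representative g) (representative f)).

Lemma htop_compE X Y Z (g : pmap Y Z) (f : pmap X Y) :
  htop_comp (htop_class g) (htop_class f) = htop_class (pmap_comp g f).
Proof.
apply/eq_classP; first exact: phomotopic_equivalence.
by apply: phomotopic_comp; apply: representativeP; exact: phomotopic_equivalence.
Qed.

Lemma htop_class_eq X Y (f g : pmap X Y) :
  f =1 g -> htop_class f = htop_class g.
Proof.
by move=> fg; apply/eq_classP; [exact: phomotopic_equivalence|exact: phomotopic_eq].
Qed.

Lemma htop_comp_assoc X Y Z W
    (h : htop_hom Z W) (g : htop_hom Y Z) (f : htop_hom X Y) :
  htop_comp h (htop_comp g f) = htop_comp (htop_comp h g) f.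
Proof.
have [[h' ->] [g' ->] [f' ->]] := And3 (eq_classI h) (eq_classI g) (eq_classI f).
rewrite (htop_compE g' f') (htop_compE h' g').
by rewrite (htop_compE h') (htop_compE _ f'); exact: htop_class_eq.
Qed.

Lemma htop_comp_idl X Y (f : htop_hom X Y) :
  htop_comp (htop_class (pmap_id Y)) f = f.
Proof.
by have [f' ->] := eq_classI f; rewrite (htop_compE _ f'); exact: htop_class_eq.
Qed.

Lemma htop_comp_idr X Y (f : htop_hom X Y) :
  htop_comp f (htop_class (pmap_id X)) = f.
Proof.
by have [f' ->] := eq_classI f; rewrite (htop_compE f'); exact: htop_class_eq.
Qed.

Definition HTop : category ptopologicalType :=
  Category htop_comp_assoc htop_comp_idl htop_comp_idr.

End PointedHomotopy.

Record simplicial_complex := SimplicialComplex {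
  vertex : choiceType;
  simplex : set (set vertex);
  simplex_finite : forall s, simplex s -> finite_set s;
  simplex_neq0 : forall s, simplex s -> s !=set0;
  simplex_face : forall s t, simplex s -> t `<=` s -> t !=set0 -> simplex t;
  simplex_vertex : forall v, simplex [set v] }.

(* Points of the geometric realization, in barycentric coordinates.           *)
Record realization (R : realType) (K : simplicial_complex) := Realization {
  bary :> vertex K -> R;
  bary_ge0 : forall v, 0 <= bary v;
  bary_carrier : simplex [set v | bary v != 0];
  bary_sum : \sum_(v \in [set: vertex K]) bary v = 1 }.

Section RealizationTopology.
Variables (R : realType) (K : simplicial_complex).

HB.instance Definition _ := gen_eqMixin (realization R K).
HB.instance Definition _ := gen_choiceMixin (realization R K).

Definition in_closed_simplex (s : set (vertex K)) (a : realization R K) :=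
  [set v | a v != 0] `<=` s.

(* Weak topology: the trace on each closed simplex is open for the Euclidean  *)
(* topology, here given by the sup distance of barycentric coordinates.       *)
Definition realization_open (U : set (realization R K)) :=
  forall s, simplex s -> forall a, in_closed_simplex s a -> U a ->
  exists2 e : R, 0 < e & forall b, in_closed_simplex s b ->
    (forall v, `|a v - b v| < e) -> U b.

Lemma realization_openT : realization_open setT.
Proof. by move=> s _ a _ _; exists 1. Qed.

Lemma realization_openI : setI_closed realization_open.
Proof.
move=> U V oU oV s Ks a sa [Ua Va].
have [e e0 eU] := oU s Ks a sa Ua; have [d d0 dV] := oV s Ks a sa Va.
exists (Num.min e d); first by rewrite lt_min e0 d0.
move=> b sb ab; split; [apply: eU|apply: dV] => // v;
  by have := ab v; rewrite lt_min => /andP[].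
Qed.

Lemma realization_open_bigU (I : Type) (f : I -> set (realization R K)) :
  (forall i, realization_open (f i)) -> realization_open (\bigcup_i f i).
Proof.
move=> of_ s Ks a sa [i _ fa]; have [e e0 ef] := of_ i s Ks a sa fa.
by exists e => // b sb ab; exists i => //; exact: ef.
Qed.

HB.instance Definition _ := isOpenTopological.Build (realization R K)
  realization_openT realization_openI realization_open_bigU.

End RealizationTopology.

Definition pointed_realization (R : realType) (K : simplicial_complex)
  (x : realization R K) : Type := realization R K.

HB.instance Definition _ (R : realType) (K : simplicial_complex)
  (x : realization R K) := Topological.on (pointed_realization x).
HB.instance Definition _ (R : realType) (K : simplicial_complex)
  (x : realization R K) := isPointed.Build (pointed_realization x) x.

(* The base point of a pointed polyhedron is an arbitrary point of [|K|].     *)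
Definition HPol (R : realType) (P : ptopologicalType) :=
  exists (K : simplicial_complex) (x : realization R K)
    (h : HTop R P (pointed_realization x)), is_iso h.

Definition sphere (R : realType) (k : nat) : Type :=
  set_type [set x : 'rV[R]_k.+1 | \sum_i x ord0 i ^+ 2 = 1].

Definition sphere_base (R : realType) (k : nat) : 'rV[R]_k.+1 :=
  \row_i (i == ord0)%:R.

Lemma sphere_base_subproof R k :
  @sphere_base R k \in [set x : 'rV[R]_k.+1 | \sum_i x ord0 i ^+ 2 = 1].
Proof.
rewrite inE /=; under eq_bigr do rewrite mxE.
by rewrite big_ord_recl eqxx expr1n big1 ?addr0 // => i _; rewrite /= expr0n.
Qed.

HB.instance Definition _ R k := Topological.on (sphere R k).
HB.instance Definition _ R k :=
  isPointed.Build (sphere R k)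
    (exist _ (sphere_base R k) (sphere_base_subproof R k)).

Section InverseSystems.
Variables (O : Type) (C : category O).

Record inverse_system := InverseSystem {
  idx : Type;
  idx_le : idx -> idx -> Prop;
  idx_le_refl : forall a, idx_le a a;
  idx_le_trans : forall a b c,
    idx_le a b -> idx_le b c -> idx_le a c;
  idx_directed : forall a b, exists c, idx_le a c /\ idx_le b c;
  idx_inhabited : inhabited idx;
  sys_term :> idx -> O;
  bond : forall a b, idx_le a b -> C (sys_term b) (sys_term a);
  bond_id : forall a (aa : idx_le a a), bond aa = idm C (sys_term a);
  bond_comp : forall a b c
    (ab : idx_le a b) (bc : idx_le b c) (ac : idx_le a c),
    bond ab \oc bond bc = bond ac }.

Implicit Types X Y Z W : inverse_system.

(* Eventual equality of two morphisms, resp. two sequences of morphisms, from *)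
(* terms of [X] to a common object: [u p_(a l) = v p_(b l)] for some [l].     *)
Definition eq_bond X T a b (u : C (X a) T) (v : C (X b) T) :=
  exists l (al : idx_le a l) (bl : idx_le b l),
    u \oc bond al = v \oc bond bl.

Definition eq_bond_seq X T a b (u : nat -> C (X a) T) (v : nat -> C (X b) T) :=
  exists l (al : idx_le a l) (bl : idx_le b l) (n : nat),
    forall n', (n <= n')%N -> u n' \oc bond al = v n' \oc bond bl.

Record S_morphism X Y := SMorphism {
  S_idx : idx Y -> idx X;
  S_map : forall m, C (X (S_idx m)) (Y m);
  S_compatible : forall m m' (mm' : idx_le m m'),
    eq_bond (bond mm' \oc S_map m') (S_map m) }.

Record Sstar_morphism X Y := SstarMorphism {
  Sstar_idx : idx Y -> idx X;
  Sstar_map : forall (n : nat) m, C (X (Sstar_idx m)) (Y m);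
  Sstar_compatible : forall m m' (mm' : idx_le m m'),
    eq_bond_seq (fun n => bond mm' \oc Sstar_map n m')
                (fun n => Sstar_map n m) }.

Definition S_equiv X Y (f g : S_morphism X Y) :=
  forall m, eq_bond (S_map f m) (S_map g m).

Definition Sstar_equiv X Y (f g : Sstar_morphism X Y) :=
  forall m, eq_bond_seq (fun n => Sstar_map f n m) (fun n => Sstar_map g n m).

Section EqBond.
Variables (X : inverse_system) (T : O).

Lemma eq_bond_seqP a b (u : C (X a) T) (v : C (X b) T) :
  eq_bond u v <-> eq_bond_seq (fun=> u) (fun=> v).
Proof.
split=> [[l [al [bl uv]]]|[l [al [bl [n uv]]]]].
  by exists l, al, bl, 0%N.
by exists l, al, bl; exact: uv (leqnn n).
Qed.

Lemma eq_bond_seq_eventually a (u v : nat -> C (X a) T) n :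
  (forall n', (n <= n')%N -> u n' = v n') -> eq_bond_seq u v.
Proof.
by move=> uv; exists a, (idx_le_refl a), (idx_le_refl a), n => n' /uv ->.
Qed.

Lemma eq_bond_seq_refl a (u : nat -> C (X a) T) : eq_bond_seq u u.
Proof. exact: (@eq_bond_seq_eventually _ _ _ 0%N). Qed.

Lemma eq_bond_seq_sym a b (u : nat -> C (X a) T) (v : nat -> C (X b) T) :
  eq_bond_seq u v -> eq_bond_seq v u.
Proof.
by move=> [l [al [bl [n uv]]]]; exists l, bl, al, n => n' /uv ->.
Qed.

Lemma eq_bond_seq_trans a b c (u : nat -> C (X a) T) (v : nat -> C (X b) T)
    (w : nat -> C (X c) T) :
  eq_bond_seq u v -> eq_bond_seq v w -> eq_bond_seq u w.
Proof.
move=> [l [al [bl [n uv]]]] [m [bm [cm [k vw]]]].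
have [r [lr mr]] := idx_directed l m.
exists r, (idx_le_trans al lr), (idx_le_trans cm mr), (maxn n k) => n'.
rewrite geq_max => /andP[nn' kn'].
rewrite -(bond_comp al lr) -(bond_comp cm mr) !comp_assoc (uv _ nn') -(vw _ kn').
rewrite -!comp_assoc (bond_comp bl lr (idx_le_trans bl lr)).
by rewrite (bond_comp bm mr (idx_le_trans bl lr)).
Qed.

Lemma eq_bond_seq_bond a b (ab : idx_le a b) (u : nat -> C (X a) T) :
  eq_bond_seq (fun n => u n \oc bond ab) u.
Proof.
exists b, (idx_le_refl b), ab, 0%N => n _.
by rewrite bond_id comp_idr.
Qed.

Lemma eq_bond_seq_postcomp S a b (u : nat -> C (X a) T) (v : nat -> C (X b) T)
    (w : nat -> C T S) :
  eq_bond_seq u v ->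
  eq_bond_seq (fun n => w n \oc u n) (fun n => w n \oc v n).
Proof.
move=> [l [al [bl [n uv]]]]; exists l, al, bl, n => n' /uv uv'.
by rewrite -!comp_assoc uv'.
Qed.

End EqBond.

Lemma eq_bond_seq_precomp X Y T (f : Sstar_morphism X Y) a b
    (u : nat -> C (Y a) T) (v : nat -> C (Y b) T) :
  eq_bond_seq u v ->
  eq_bond_seq (fun n => u n \oc Sstar_map f n a)
              (fun n => v n \oc Sstar_map f n b).
Proof.
move=> [l [al [bl [n uv]]]].
have fP c (cl : idx_le c l) (w : nat -> C (Y c) T) :
    eq_bond_seq (fun n => w n \oc Sstar_map f n c)
                (fun n => w n \oc bond cl \oc Sstar_map f n l).
  apply: eq_bond_seq_sym.
  apply: (eq_bond_seq_trans _ (eq_bond_seq_postcomp w (Sstar_compatible f cl))).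
  by apply: (@eq_bond_seq_eventually _ _ _ _ _ 0%N) => k _; rewrite comp_assoc.
apply: (eq_bond_seq_trans (fP a al u)).
apply: (eq_bond_seq_trans _ (eq_bond_seq_sym (fP b bl v))).
by apply: (@eq_bond_seq_eventually _ _ _ _ _ n) => k /uv ->.
Qed.

Lemma Sstar_equivalence X Y : equivalence_prop (@Sstar_equiv X Y).
Proof.
split=> [f m|f g fg m|f g h fg gh m].
- exact: eq_bond_seq_refl.
- exact/eq_bond_seq_sym/fg.
- exact: eq_bond_seq_trans (fg m) (gh m).
Qed.

Lemma Sstar_id_compatible X m m' (mm' : idx_le m m') :
  eq_bond_seq (fun=> bond mm' \oc idm C (X m')) (fun=> idm C (X m)).
Proof.
apply: (eq_bond_seq_trans _ (eq_bond_seq_bond mm' (fun=> idm C (X m)))).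
by apply: (@eq_bond_seq_eventually _ _ _ _ _ 0%N) => k _;
  rewrite comp_idl comp_idr.
Qed.

Definition Sstar_id X : Sstar_morphism X X :=
  SstarMorphism (@Sstar_id_compatible X).

Lemma Sstar_comp_compatible X Y Z (g : Sstar_morphism Y Z)
    (f : Sstar_morphism X Y) m m' (mm' : idx_le m m') :
  eq_bond_seq
    (fun n => bond mm' \oc (Sstar_map g n m' \oc Sstar_map f n (Sstar_idx g m')))
    (fun n => Sstar_map g n m \oc Sstar_map f n (Sstar_idx g m)).
Proof.
apply: (eq_bond_seq_trans _ (eq_bond_seq_precomp f (Sstar_compatible g mm'))).
by apply: (@eq_bond_seq_eventually _ _ _ _ _ 0%N) => k _; rewrite comp_assoc.
Qed.

Definition Sstar_comp X Y Z (g : Sstar_morphism Y Z) (f : Sstar_morphism X Y) :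
    Sstar_morphism X Z :=
  SstarMorphism (@Sstar_comp_compatible X Y Z g f).

Lemma Sstar_comp_equiv X Y Z (g g' : Sstar_morphism Y Z)
    (f f' : Sstar_morphism X Y) :
  Sstar_equiv g g' -> Sstar_equiv f f' ->
  Sstar_equiv (Sstar_comp g f) (Sstar_comp g' f').
Proof.
move=> gg' ff' m; apply: (eq_bond_seq_trans (eq_bond_seq_precomp f (gg' m))).
exact: eq_bond_seq_postcomp (ff' _).
Qed.

(* The inclusion of pro-C into pro*-C is used to transfer the category laws.  *)
Lemma S_const_compatible X Y (f : S_morphism X Y) m m' (mm' : idx_le m m') :
  eq_bond_seq (fun=> bond mm' \oc S_map f m') (fun=> S_map f m).
Proof. exact/eq_bond_seqP/S_compatible. Qed.

Definition S_const X Y (f : S_morphism X Y) : Sstar_morphism X Y :=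
  SstarMorphism (@S_const_compatible X Y f).

Lemma S_const_equiv X Y (f g : S_morphism X Y) :
  Sstar_equiv (S_const f) (S_const g) <-> S_equiv f g.
Proof. by split=> fg m; apply/eq_bond_seqP/fg. Qed.

Lemma S_equivalence X Y : equivalence_prop (@S_equiv X Y).
Proof.
have eqS := Sstar_equivalence X Y.
split=> [f|f g /S_const_equiv fg|f g h /S_const_equiv fg /S_const_equiv gh];
  apply/S_const_equiv.
- exact: (eqv_refl eqS).
- exact: (eqv_sym eqS).
- exact: (eqv_trans eqS) fg gh.
Qed.

Lemma S_id_compatible X m m' (mm' : idx_le m m') :
  eq_bond (bond mm' \oc idm C (X m')) (idm C (X m)).
Proof. exact/eq_bond_seqP/Sstar_id_compatible. Qed.

Definition S_id X : S_morphism X X := SMorphism (@S_id_compatible X).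

Lemma S_comp_compatible X Y Z (g : S_morphism Y Z) (f : S_morphism X Y)
    m m' (mm' : idx_le m m') :
  eq_bond (bond mm' \oc (S_map g m' \oc S_map f (S_idx g m')))
          (S_map g m \oc S_map f (S_idx g m)).
Proof.
exact/eq_bond_seqP/(Sstar_comp_compatible (S_const g) (S_const f)).
Qed.

Definition S_comp X Y Z (g : S_morphism Y Z) (f : S_morphism X Y) :
    S_morphism X Z :=
  SMorphism (@S_comp_compatible X Y Z g f).

Lemma S_comp_equiv X Y Z (g g' : S_morphism Y Z) (f f' : S_morphism X Y) :
  S_equiv g g' -> S_equiv f f' -> S_equiv (S_comp g f) (S_comp g' f').
Proof.
move=> /S_const_equiv gg' /S_const_equiv ff'; apply/S_const_equiv.
exact: Sstar_comp_equiv gg' ff'.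
Qed.

Definition pro_class X Y (f : S_morphism X Y) := eq_class (@S_equiv X Y) f.

Definition prostar_class X Y (f : Sstar_morphism X Y) :=
  eq_class (@Sstar_equiv X Y) f.

Definition pro_comp X Y Z (g : quot (@S_equiv Y Z)) (f : quot (@S_equiv X Y)) :=
  pro_class (S_comp (representative g) (representative f)).

Definition prostar_comp X Y Z (g : quot (@Sstar_equiv Y Z))
    (f : quot (@Sstar_equiv X Y)) :=
  prostar_class (Sstar_comp (representative g) (representative f)).

Lemma pro_compE X Y Z (g : S_morphism Y Z) (f : S_morphism X Y) :
  pro_comp (pro_class g) (pro_class f) = pro_class (S_comp g f).
Proof.
apply/eq_classP; first exact: S_equivalence.
by apply: S_comp_equiv; exact: (representativeP (S_equivalence _ _)).
Qed.

Lemma prostar_compE X Y Z (g : Sstar_morphism Y Z) (f : Sstar_morphism X Y) :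
  prostar_comp (prostar_class g) (prostar_class f) =
  prostar_class (Sstar_comp g f).
Proof.
apply/eq_classP; first exact: Sstar_equivalence.
by apply: Sstar_comp_equiv; exact: (representativeP (Sstar_equivalence _ _)).
Qed.

Lemma Sstar_comp_assoc X Y Z W (h : Sstar_morphism Z W)
    (g : Sstar_morphism Y Z) (f : Sstar_morphism X Y) :
  Sstar_equiv (Sstar_comp h (Sstar_comp g f)) (Sstar_comp (Sstar_comp h g) f).
Proof.
by move=> m; apply: (@eq_bond_seq_eventually _ _ _ _ _ 0%N) => k _;
  rewrite /= comp_assoc.
Qed.

Lemma Sstar_comp_idl X Y (f : Sstar_morphism X Y) :
  Sstar_equiv (Sstar_comp (Sstar_id Y) f) f.
Proof.
by move=> m; apply: (@eq_bond_seq_eventually _ _ _ _ _ 0%N) => k _;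
  rewrite /= comp_idl.
Qed.

Lemma Sstar_comp_idr X Y (f : Sstar_morphism X Y) :
  Sstar_equiv (Sstar_comp f (Sstar_id X)) f.
Proof.
by move=> m; apply: (@eq_bond_seq_eventually _ _ _ _ _ 0%N) => k _;
  rewrite /= comp_idr.
Qed.

Lemma prostar_eq X Y (f g : Sstar_morphism X Y) :
  Sstar_equiv f g -> prostar_class f = prostar_class g.
Proof. by move=> fg; apply/eq_classP => //; exact: Sstar_equivalence. Qed.

Lemma pro_eq X Y (f g : S_morphism X Y) :
  S_equiv f g -> pro_class f = pro_class g.
Proof. by move=> fg; apply/eq_classP => //; exact: S_equivalence. Qed.

Lemma prostar_comp_assoc X Y Z W (h : quot (@Sstar_equiv Z W))
    (g : quot (@Sstar_equiv Y Z)) (f : quot (@Sstar_equiv X Y)) :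
  prostar_comp h (prostar_comp g f) = prostar_comp (prostar_comp h g) f.
Proof.
have [[h' ->] [g' ->] [f' ->]] := And3 (eq_classI h) (eq_classI g) (eq_classI f).
rewrite (prostar_compE g' f') (prostar_compE h' g').
rewrite (prostar_compE h') (prostar_compE _ f').
exact/prostar_eq/Sstar_comp_assoc.
Qed.

Lemma prostar_comp_idl X Y (f : quot (@Sstar_equiv X Y)) :
  prostar_comp (prostar_class (Sstar_id Y)) f = f.
Proof.
have [f' ->] := eq_classI f; rewrite (prostar_compE _ f').
exact/prostar_eq/Sstar_comp_idl.
Qed.

Lemma prostar_comp_idr X Y (f : quot (@Sstar_equiv X Y)) :
  prostar_comp f (prostar_class (Sstar_id X)) = f.
Proof.
have [f' ->] := eq_classI f; rewrite (prostar_compE f').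
exact/prostar_eq/Sstar_comp_idr.
Qed.

Lemma pro_comp_assoc X Y Z W (h : quot (@S_equiv Z W))
    (g : quot (@S_equiv Y Z)) (f : quot (@S_equiv X Y)) :
  pro_comp h (pro_comp g f) = pro_comp (pro_comp h g) f.
Proof.
have [[h' ->] [g' ->] [f' ->]] := And3 (eq_classI h) (eq_classI g) (eq_classI f).
rewrite (pro_compE g' f') (pro_compE h' g') (pro_compE h') (pro_compE _ f').
apply/pro_eq/S_const_equiv.
exact: (Sstar_comp_assoc (S_const h') (S_const g') (S_const f')).
Qed.

Lemma pro_comp_idl X Y (f : quot (@S_equiv X Y)) :
  pro_comp (pro_class (S_id Y)) f = f.
Proof.
have [f' ->] := eq_classI f; rewrite (pro_compE _ f').
exact/pro_eq/S_const_equiv/(Sstar_comp_idl (S_const f')).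
Qed.

Lemma pro_comp_idr X Y (f : quot (@S_equiv X Y)) :
  pro_comp f (pro_class (S_id X)) = f.
Proof.
have [f' ->] := eq_classI f; rewrite (pro_compE f').
exact/pro_eq/S_const_equiv/(Sstar_comp_idr (S_const f')).
Qed.

Definition pro : category inverse_system :=
  Category pro_comp_assoc pro_comp_idl pro_comp_idr.

Definition prostar : category inverse_system :=
  Category prostar_comp_assoc prostar_comp_idl prostar_comp_idr.

Definition pro_const X Y (f : pro X Y) : prostar X Y :=
  prostar_class (S_const (representative f)).

Lemma pro_constE X Y (f : S_morphism X Y) :
  pro_const (pro_class f) = prostar_class (S_const f).
Proof.
apply/prostar_eq/S_const_equiv; exact: (representativeP (S_equivalence _ _)).
Qed.

Lemma pro_const_id X : pro_const (idm pro X) = idm prostar X.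
Proof. by rewrite pro_constE; apply: prostar_eq => m; exact: eq_bond_seq_refl. Qed.

Lemma pro_const_comp X Y Z (g : pro Y Z) (f : pro X Y) :
  pro_const (g \oc f) = pro_const g \oc pro_const f.
Proof.
have [[g' ->] [f' ->]] := conj (eq_classI g) (eq_classI f).
rewrite /ccomp /= (pro_compE g' f') !pro_constE (prostar_compE (S_const g')).
by apply: prostar_eq => m; exact: eq_bond_seq_refl.
Qed.

Definition pro_inclusion : io_functor pro prostar :=
  IOFunctor pro_const_id pro_const_comp.

Section Rudimentary.
Variable P : O.

Lemma rudimentary_comp (a b c : unit) (ab bc ac : True) :
  idm C P \oc idm C P = idm C P.
Proof. exact: comp_idl. Qed.

Definition rudimentary : inverse_system :=
  @InverseSystem unit (fun _ _ => True) (fun=> I) (fun _ _ _ _ _ => I)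
    (fun _ _ => ex_intro _ tt (conj I I)) (inhabits tt) (fun=> P)
    (fun _ _ _ => idm C P) (fun _ _ => erefl) rudimentary_comp.

End Rudimentary.

End InverseSystems.

Arguments rudimentary {O} C P.

Section Expansions.
Variables (O : Type) (C : category O) (D : O -> Prop).

Record expansion (X : O) := Expansion {
  exp_system :> inverse_system C;
  exp_term : forall a, D (exp_system a);
  exp_proj : forall a, C X (exp_system a);
  proj_compatible : forall a b (ab : idx_le a b),
    bond ab \oc exp_proj b = exp_proj a;
  expansion_E1 : forall P, D P -> forall h : C X P,
    exists a (f : C (exp_system a) P), h = f \oc exp_proj a;
  expansion_E2 : forall P, D P -> forall a (f0 f1 : C (exp_system a) P),
    f0 \oc exp_proj a = f1 \oc exp_proj a ->
    exists b (ab : idx_le a b), f0 \oc bond ab = f1 \oc bond ab }.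

Arguments exp_term {X} e a.
Arguments exp_proj {X} e a.

Lemma proj_S_compatible X (p : expansion X) (a b : idx p) (ab : idx_le a b) :
  @eq_bond _ _ (rudimentary C X) _ tt tt (bond ab \oc exp_proj p b) (exp_proj p a).
Proof. by exists tt, I, I; rewrite proj_compatible. Qed.

(* The expansion, as a morphism of pro-C from the rudimentary system [X].     *)
Definition proj_pro X (p : expansion X) : pro C (rudimentary C X) p :=
  pro_class (@SMorphism _ _ (rudimentary C X) p (fun=> tt) (exp_proj p)
    (@proj_S_compatible X p)).

Lemma rudimentary_S_compatible X Y (h : C X Y) a b
    (ab : @idx_le _ _ (rudimentary C Y) a b) :
  @eq_bond _ _ (rudimentary C X) _ tt tt (bond ab \oc h) h.
Proof. by exists tt, I, I; rewrite /= !comp_idr comp_idl. Qed.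

Definition rudimentary_pro X Y (h : C X Y) :
    pro C (rudimentary C X) (rudimentary C Y) :=
  pro_class (@SMorphism _ _ (rudimentary C X) (rudimentary C Y) (fun=> tt)
    (fun=> h) (@rudimentary_S_compatible X Y h)).

Lemma induced_exists X Y (p : expansion X) (q : expansion Y) (h : C X Y) :
  exists f : pro C p q, f \oc proj_pro p = proj_pro q \oc rudimentary_pro h.
Proof.
pose F b := cid (expansion_E1 p (exp_term q b) (exp_proj q b \oc h)).
pose i b := projT1 (F b); pose G b := cid (projT2 (F b)).
pose f b : C (p (i b)) (q b) := projT1 (G b).
have fP b : exp_proj q b \oc h = f b \oc exp_proj p (i b) := projT2 (G b).
have fC b b' (bb' : idx_le b b') : eq_bond (bond bb' \oc f b') (f b).
  have [l [bl b'l]] := idx_directed (i b) (i b').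
  have [|k [lk E]] := @expansion_E2 _ p _ (exp_term q b) l
      (bond bb' \oc f b' \oc bond b'l) (f b \oc bond bl).
    rewrite -!comp_assoc !proj_compatible -!fP.
    by rewrite comp_assoc proj_compatible.
  exists k, (idx_le_trans b'l lk), (idx_le_trans bl lk).
  by rewrite -(bond_comp b'l lk) -(bond_comp bl lk) !comp_assoc.
exists (pro_class (SMorphism fC)).
rewrite /ccomp /= !pro_compE; apply: pro_eq => b /=.
by exists tt, I, I; rewrite -fP.
Qed.

Lemma proj_pro_epi X (p : expansion X) (Y : inverse_system C)
    (f g : pro C p Y) : (forall b, D (Y b)) ->
  f \oc proj_pro p = g \oc proj_pro p -> f = g.
Proof.
have [[f' ->] [g' ->]] := conj (eq_classI f) (eq_classI g) => DY.
rewrite /ccomp /= !pro_compE => /eq_classP - /(_ (S_equivalence _ _)) fg.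
apply: pro_eq => b; have [_ [_ [_ /=]]] := fg b; rewrite !comp_idr => fgb.
have [l [al bl]] := idx_directed (S_idx f' b) (S_idx g' b).
have [|k [lk E]] := @expansion_E2 _ p _ (DY b) l
    (S_map f' b \oc bond al) (S_map g' b \oc bond bl).
  by rewrite -!comp_assoc !proj_compatible.
exists k, (idx_le_trans al lk), (idx_le_trans bl lk).
by rewrite -(bond_comp al lk) -(bond_comp bl lk) !comp_assoc.
Qed.

Definition induced X Y (p : expansion X) (q : expansion Y) (h : C X Y) :
    pro C p q :=
  projT1 (cid (induced_exists p q h)).

Lemma inducedP X Y (p : expansion X) (q : expansion Y) (h : C X Y) :
  induced p q h \oc proj_pro p = proj_pro q \oc rudimentary_pro h.
Proof. exact: projT2 (cid (induced_exists p q h)). Qed.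

Lemma rudimentary_pro_id X : rudimentary_pro (idm C X) = idm (pro C) _.
Proof.
apply: pro_eq => -[]; exists tt, I, I; exact: erefl.
Qed.

Lemma rudimentary_pro_comp X Y Z (g : C Y Z) (f : C X Y) :
  rudimentary_pro (g \oc f) = rudimentary_pro g \oc rudimentary_pro f.
Proof.
rewrite /ccomp /= !pro_compE.
by apply: pro_eq => -[]; exists tt, I, I; exact: erefl.
Qed.

Lemma induced_comp X Y Z (p : expansion X) (q : expansion Y) (r : expansion Z)
    (g : C Y Z) (f : C X Y) :
  induced q r g \oc induced p q f = induced p r (g \oc f).
Proof.
apply: (@proj_pro_epi _ p) => [b|]; first exact: exp_term.
rewrite -comp_assoc !inducedP comp_assoc inducedP.
by rewrite rudimentary_pro_comp comp_assoc.
Qed.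

Lemma induced_id X (p : expansion X) : induced p p (idm C X) = idm (pro C) p.
Proof.
apply: (@proj_pro_epi _ p) => [b|]; first exact: exp_term.
by rewrite inducedP rudimentary_pro_id comp_idl comp_idr.
Qed.

(* The unique compatible isomorphism: see [canonicalP] and [canonical_iso].   *)
Definition canonical X (p p' : expansion X) : pro C p p' :=
  induced p p' (idm C X).

Lemma canonicalP X (p p' : expansion X) (i : pro C p p') :
  i = canonical p p' <-> i \oc proj_pro p = proj_pro p'.
Proof.
have cP : canonical p p' \oc proj_pro p = proj_pro p'.
  by rewrite inducedP rudimentary_pro_id comp_idr.
split=> [-> //|iP]; apply: (@proj_pro_epi _ p) => [b|]; first exact: exp_term.
by rewrite iP.
Qed.

Lemma canonical_comp X (p p' p'' : expansion X) :
  canonical p' p'' \oc canonical p p' = canonical p p''.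
Proof. by rewrite /canonical induced_comp comp_idl. Qed.

Lemma canonical_id X (p : expansion X) : canonical p p = idm (pro C) p.
Proof. exact: induced_id. Qed.

Lemma canonical_iso X (p p' : expansion X) : is_iso (canonical p p').
Proof. by exists (canonical p' p); rewrite !canonical_comp !canonical_id. Qed.

Section RudimentaryExpansion.
Variables (P : O) (DP : D P).

Lemma rudimentary_E1 Q : D Q -> forall h : C P Q,
  exists (a : unit) (f : C P Q), h = f \oc idm C P.
Proof. by move=> _ h; exists tt, h; rewrite comp_idr. Qed.

Lemma rudimentary_E2 Q : D Q -> forall (a : unit) (f0 f1 : C P Q),
  f0 \oc idm C P = f1 \oc idm C P ->
  exists (b : unit) (ab : True), f0 \oc idm C P = f1 \oc idm C P.
Proof. by move=> _ a f0 f1 E; exists tt, I. Qed.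

Definition rudimentary_expansion : expansion P :=
  @Expansion P (rudimentary C P) (fun=> DP) (fun=> idm C P)
    (fun _ _ _ => comp_idl _) rudimentary_E1 rudimentary_E2.

End RudimentaryExpansion.

End Expansions.

Arguments exp_term {O C D X} e a.
Arguments exp_proj {O C D X} e a.

(* Pointed shape and coarse shape morphisms are treated uniformly: [E] is     *)
(* pro-C or pro*-C and [I : pro C -> E] is the identity or the inclusion.     *)
Section Shape.
Variables (O : Type) (C : category O) (D : O -> Prop).
Variables (E : category (inverse_system C)) (I : io_functor (pro C) E).

Record shape_repr (X Y : O) := ShapeRepr {
  repr_dom : expansion C D X;
  repr_cod : expansion C D Y;
  repr_map : E repr_dom repr_cod }.

Definition shape_equiv X Y (F G : shape_repr X Y) :=
  I _ _ (canonical (repr_cod F) (repr_cod G)) \oc repr_map F =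
  repr_map G \oc I _ _ (canonical (repr_dom F) (repr_dom G)).

Lemma shape_equivalence X Y : equivalence_prop (@shape_equiv X Y).
Proof.
split=> [F|F G FG|F G H FG GH]; rewrite /shape_equiv.
- by rewrite !canonical_id !fmap_id comp_idl comp_idr.
- rewrite -[repr_map G]comp_idr -(fmap_id I) -(canonical_id (repr_dom G)).
  rewrite -(canonical_comp _ (repr_dom F)) fmap_comp.
  rewrite [repr_map G \oc _]comp_assoc -FG !comp_assoc -fmap_comp.
  by rewrite canonical_comp canonical_id fmap_id comp_idl.
- rewrite -(canonical_comp _ (repr_cod G)) fmap_comp -comp_assoc FG comp_assoc GH.
  by rewrite -comp_assoc -fmap_comp canonical_comp.
Qed.

Definition shape X Y : Type := quot (@shape_equiv X Y).

Definition shape_class X Y (p : expansion C D X) (q : expansion C D Y)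
    (f : E p q) : shape X Y :=
  eq_class (@shape_equiv X Y) (ShapeRepr f).

Lemma shape_classP X Y (p p' : expansion C D X) (q q' : expansion C D Y)
    (f : E p q) (f' : E p' q') :
  shape_class f = shape_class f' <->
  I _ _ (canonical q q') \oc f = f' \oc I _ _ (canonical p p').
Proof. exact: (eq_classP (shape_equivalence X Y)). Qed.

Lemma shape_class_inj X Y (p : expansion C D X) (q : expansion C D Y)
    (f f' : E p q) : shape_class f = shape_class f' -> f = f'.
Proof.
by move=> /shape_classP; rewrite !canonical_id !fmap_id comp_idl comp_idr.
Qed.

Lemma shape_classI X Y (p : expansion C D X) (q : expansion C D Y)
    (F : shape X Y) : exists f : E p q, F = shape_class f.
Proof.
have [[p' q' f'] ->] := eq_classI F.
exists (I _ _ (canonical q' q) \oc f' \oc I _ _ (canonical p p')).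
apply/shape_classP.
by rewrite -comp_assoc -fmap_comp canonical_comp canonical_id fmap_id comp_idr.
Qed.

Definition shape_comp X Y Z (G : shape Y Z) (F : shape X Y) : shape X Z :=
  let f := representative F in let g := representative G in
  shape_class (repr_map g \oc I _ _ (canonical (repr_cod f) (repr_dom g))
               \oc repr_map f).

Lemma shape_compE X Y Z (p : expansion C D X) (q : expansion C D Y)
    (r : expansion C D Z) (g : E q r) (f : E p q) :
  shape_comp (shape_class g) (shape_class f) = shape_class (g \oc f).
Proof.
rewrite /shape_comp.
have := representativeP (shape_equivalence _ _) (ShapeRepr f).
have := representativeP (shape_equivalence _ _) (ShapeRepr g).
rewrite -/(shape_class g) -/(shape_class f) /shape_equiv /=.
move: (representative (shape_class g)) => [q2 r2 g2] /=.
move: (representative (shape_class f)) => [p1 q1 f1] /= gE fE.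
apply/shape_classP; rewrite -comp_assoc comp_assoc gE -!comp_assoc.
congr (_ \oc _); rewrite -fE !comp_assoc -fmap_comp canonical_comp.
by [].
Qed.

Lemma shape_comp_assoc X Y Z W (p : expansion C D X) (q : expansion C D Y)
    (r : expansion C D Z) (s : expansion C D W)
    (H : shape Z W) (G : shape Y Z) (F : shape X Y) :
  shape_comp H (shape_comp G F) = shape_comp (shape_comp H G) F.
Proof.
have [h ->] := shape_classI r s H; have [g ->] := shape_classI q r G.
have [f ->] := shape_classI p q F.
by rewrite !shape_compE comp_assoc.
Qed.

(* The morphism of [shape X Y] induced by [h : C X Y], computed in expansions *)
(* [p] of [X] and [q] of [Y]; it does not depend on them.                     *)
Definition shape_induced X Y (p : expansion C D X) (q : expansion C D Y)
    (h : C X Y) : shape X Y :=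
  shape_class (I _ _ (induced p q h)).

Lemma shape_induced_indep X Y (p p' : expansion C D X) (q q' : expansion C D Y)
    (h : C X Y) : shape_induced p q h = shape_induced p' q' h.
Proof.
apply/shape_classP; rewrite -!fmap_comp /canonical !induced_comp.
by rewrite comp_idl comp_idr.
Qed.

Definition shape_proj X (p : expansion C D X) (a : idx p) : shape X (p a) :=
  shape_induced p (rudimentary_expansion C (exp_term p a)) (exp_proj p a).

Arguments shape_proj {X} p a.

Lemma bond_shape_proj X (p : expansion C D X) a b (ab : idx_le a b) :
  shape_comp (shape_induced (rudimentary_expansion C (exp_term p b))
      (rudimentary_expansion C (exp_term p a)) (bond ab)) (shape_proj p b) =
  shape_proj p a.
Proof.
by rewrite shape_compE -fmap_comp induced_comp proj_compatible.
Qed.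

Definition shape_basis Y X (p : expansion C D X) (i : shape Y X * idx p) :
    shape Y X -> Prop :=
  fun G => shape_comp (shape_proj p i.2) i.1 = shape_comp (shape_proj p i.2) G.

Arguments shape_basis {Y X} p i.

Lemma shape_basis_cover Y X (p : expansion C D X) (F : shape Y X) :
  exists i : shape Y X * idx p, shape_basis p i F.
Proof. by have [a] := idx_inhabited p; exists (F, a). Qed.

Lemma shape_basis_meet Y X (p : expansion C D X)
    (i j : shape Y X * idx p) (F : shape Y X) :
  shape_basis p i F -> shape_basis p j F -> exists k, shape_basis p k F /\
    forall G, shape_basis p k G -> shape_basis p i G /\ shape_basis p j G.
Proof.
case: i j => [Fi a] [Fj b]; rewrite /shape_basis /= => iF jF.
have [c [ac bc]] := idx_directed a b.
exists (F, c); split=> //= G FG.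
have le d (dc : idx_le d c) :
    shape_comp (shape_proj p d) F = shape_comp (shape_proj p d) G.
  have [[q _ _] _] := eq_classI F.
  rewrite -(bond_shape_proj dc).
  have assoc := @shape_comp_assoc _ _ _ _ q p
    (rudimentary_expansion C (exp_term p c))
    (rudimentary_expansion C (exp_term p d)).
  by rewrite -!assoc FG.
by rewrite iF jF; split; exact: le.
Qed.

End Shape.

Arguments shape {O} C D {E} I X Y.
Arguments shape_class {O C D E} I {X Y p q} f.
Arguments shape_proj {O C D E} I {X} p a.
Arguments shape_basis {O C D E} I {Y X} p i.

(* [topologicalType] cannot be used on sets of shape morphisms: quantifying   *)
(* over all expansions puts them above its universe.                          *)
Record topology_on (T : Type) := TopologyOn {
  is_open : (T -> Prop) -> Prop;
  is_open_full : is_open (fun=> True);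
  is_open_meet : forall U V,
    is_open U -> is_open V -> is_open (fun x => U x /\ V x);
  is_open_union : forall (I : Type) (U : I -> T -> Prop),
    (forall i, is_open (U i)) -> is_open (fun x => exists i, U i x) }.

Section TopologyOfBasis.
Variables (T I : Type) (B : I -> T -> Prop).
Hypothesis B_cover : forall x, exists i, B i x.
Hypothesis B_meet : forall i j x, B i x -> B j x ->
  exists k, B k x /\ forall y, B k y -> B i y /\ B j y.

Definition basis_open (U : T -> Prop) :=
  forall x, U x -> exists i, B i x /\ forall y, B i y -> U y.

Lemma basis_open_full : basis_open (fun=> True).
Proof. by move=> x _; have [i Bx] := B_cover x; exists i. Qed.

Lemma basis_open_meet U V :
  basis_open U -> basis_open V -> basis_open (fun x => U x /\ V x).
Proof.
move=> oU oV x [Ux Vx]; have [i [Bi iU]] := oU x Ux.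
have [j [Bj jV]] := oV x Vx; have [k [Bk kij]] := B_meet Bi Bj.
by exists k; split=> // y /kij [/iU Uy /jV Vy].
Qed.

Lemma basis_open_union (J : Type) (U : J -> T -> Prop) :
  (forall j, basis_open (U j)) -> basis_open (fun x => exists j, U j x).
Proof.
move=> oU x [j Ujx]; have [i [Bi iU]] := oU j x Ujx.
by exists i; split=> // y /iU; exists j.
Qed.

Definition topology_of_basis : topology_on T :=
  TopologyOn basis_open_full basis_open_meet basis_open_union.

End TopologyOfBasis.

Definition topological_embedding (S T : Type) (tS : topology_on S)
    (tT : topology_on T) (f : S -> T) :=
  [/\ injective f,
      forall V, is_open tT V -> is_open tS (fun x => V (f x)) &
      forall U, is_open tS U -> exists2 V, is_open tT V &
        forall y, (exists2 x, U x & f x = y) <-> V y /\ exists x, f x = y].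

Definition shape_topology (O : Type) (C : category O) (D : O -> Prop)
    (E : category (inverse_system C)) (I : io_functor (pro C) E) (Y X : O)
    (p : expansion C D X) : topology_on (shape C D I Y X) :=
  topology_of_basis (@shape_basis_cover O C D E I Y X p)
                    (@shape_basis_meet O C D E I Y X p).

Section Pointed.
Variable R : realType.

Definition HPol_expansion (X : ptopologicalType) :=
  expansion (HTop R) (HPol R) X.

Definition Sh (Y X : ptopologicalType) : Type :=
  shape (HTop R) (HPol R) (id_functor (pro (HTop R))) Y X.

Definition Sh_class Y X (q : HPol_expansion Y) (p : HPol_expansion X)
    (f : S_morphism q p) : Sh Y X :=
  shape_class (id_functor (pro (HTop R))) (pro_class f).

Definition Sh_topology Y X (p : HPol_expansion X) : topology_on (Sh Y X) :=
  shape_topology (id_functor (pro (HTop R))) Y p.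

Definition Shstar (Y X : ptopologicalType) : Type :=
  shape (HTop R) (HPol R) (pro_inclusion (HTop R)) Y X.

Definition Shstar_class Y X (q : HPol_expansion Y) (p : HPol_expansion X)
    (f : Sstar_morphism q p) : Shstar Y X :=
  shape_class (pro_inclusion (HTop R)) (prostar_class f).

Definition Shstar_topology Y X (p : HPol_expansion X) :
    topology_on (Shstar Y X) :=
  shape_topology (pro_inclusion (HTop R)) Y p.

(* Independent of the chosen representative: see [Sh_to_ShstarE].             *)
Definition Sh_to_Shstar Y X (F : Sh Y X) : Shstar Y X :=
  shape_class (pro_inclusion (HTop R))
    (pro_inclusion (HTop R) _ _ (repr_map (representative F))).

Lemma Sh_to_ShstarE Y X (q : HPol_expansion Y) (p : HPol_expansion X)
    (f : S_morphism q p) :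
  Sh_to_Shstar (Sh_class f) = Shstar_class (S_const f).
Proof.
rewrite /Shstar_class -pro_constE /Sh_to_Shstar.
apply/shape_classP; rewrite -!(fmap_comp (pro_inclusion (HTop R))).
congr (fmap _ _).
have := representativeP (shape_equivalence (HPol R) (id_functor _) Y X)
  (@ShapeRepr _ _ _ (pro (HTop R)) Y X q p (pro_class f)).
exact.
Qed.

Definition shape_pi (k : nat) (X : ptopologicalType) : Type :=
  Sh (sphere R k) X.

Definition shape_pi_top (k : nat) X (p : HPol_expansion X) :
    topology_on (shape_pi k X) :=
  Sh_topology (sphere R k) p.

Definition coarse_shape_pi (k : nat) (X : ptopologicalType) : Type :=
  Shstar (sphere R k) X.

Definition coarse_shape_pi_top (k : nat) X (p : HPol_expansion X) :
    topology_on (coarse_shape_pi k X) :=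
  Shstar_topology (sphere R k) p.

Definition J (k : nat) (X : ptopologicalType) :
    shape_pi k X -> coarse_shape_pi k X :=
  @Sh_to_Shstar (sphere R k) X.

End Pointed.

(* Main.v *)
Require Import Defs.
From mathcomp Require Import all_boot all_order all_algebra.
From mathcomp Require Import all_classical all_reals all_analysis.

(** Since pro-HTop is a faithful subcategory of pro*-HTop, the map J is
    injective and commutes with composition; in particular it satisfies
    [p_a J(F) = J(p_a F)]. By injectivity [p_a J(F) = p_a J(G)] is then
    equivalent to [p_a F = p_a G], so the basic neighbourhoods of J(F) cut out
    on the image of J exactly the images of those of F. *)

Set Implicit Arguments.
Unset Strict Implicit.
Unset Printing Implicit Defensive.

(** Constant sequences that agree from some index on are equal, so [Sstar_equiv] between them is
    just [S_equiv]. *)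
Lemma pro_inclusion_faithful (O : Type) (C : category O)
    (S T : inverse_system C) (f g : pro C S T) :
  pro_inclusion C S T f = pro_inclusion C S T g -> f = g.
Proof.
have [[f' ->] [g' ->]] := conj (eq_classI f) (eq_classI g).
rewrite /= !pro_constE => /eq_classP - /(_ (Sstar_equivalence _ _)) fg.
exact/pro_eq/S_const_equiv.
Qed.

Section ShapeToCoarseShape.
Variable R : realType.
Implicit Types X Y Z : ptopologicalType.

Local Notation C := (HTop R).
Local Notation I := (id_functor (pro C)).
Local Notation Istar := (pro_inclusion C).

Lemma Sh_to_Shstar_class Y X (q : HPol_expansion R Y) (p : HPol_expansion R X)
    (f : pro C q p) :
  Sh_to_Shstar (shape_class I f : Sh R Y X) =
  shape_class Istar (Istar _ _ f).
Proof.
have [f' ->] := eq_classI f.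
by rewrite [LHS]Sh_to_ShstarE /Shstar_class -pro_constE.
Qed.

Lemma Sh_to_Shstar_inj Y X : injective (@Sh_to_Shstar R Y X).
Proof.
move=> F G; have [[q p f] ->] := eq_classI F.
(* Represent [G] over the expansions of [F]: for fixed expansions [shape_class] is injective. *)
have [g ->] := shape_classI q p G.
rewrite -/(shape_class I f) !Sh_to_Shstar_class => JFG.
by rewrite (pro_inclusion_faithful (shape_class_inj JFG)).
Qed.

Lemma Sh_to_Shstar_comp_induced Y X Z (p : HPol_expansion R X)
    (r : HPol_expansion R Z) (h : C X Z) (F : Sh R Y X) :
  shape_comp (shape_induced Istar p r h) (Sh_to_Shstar F) =
  Sh_to_Shstar (shape_comp (shape_induced I p r h) F).
Proof.
(* A representative of [F] supplies an expansion [q] of [Y]; [F] is then rewritten over [q] and the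
   given [p]. *)
have [[q p' _] _] := eq_classI F; have [f ->] := shape_classI q p F.
by rewrite shape_compE !Sh_to_Shstar_class shape_compE -Defs.fmap_comp.
Qed.

Lemma shape_basis_Sh_to_Shstar Y X (p : HPol_expansion R X) (a : idx p)
    (F G : Sh R Y X) :
  shape_basis Istar p (Sh_to_Shstar F, a) (Sh_to_Shstar G) <->
  shape_basis I p (F, a) G.
Proof.
rewrite /shape_basis /shape_proj /= !Sh_to_Shstar_comp_induced.
by split=> [/Sh_to_Shstar_inj|->].
Qed.

Lemma Sh_to_Shstar_embedding Y X (p : HPol_expansion R X) :
  topological_embedding (Sh_topology Y p) (Shstar_topology Y p)
    (@Sh_to_Shstar R Y X).
Proof.
split=> [|V oV F VF|U oU]; first exact: Sh_to_Shstar_inj.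
  (* The centre [F0] may lie outside the image, so its basic set is recentred at
     [Sh_to_Shstar F]. *)
  have [[F0 a] [F0F F0V]] := oV _ VF.
  exists (F, a); split=> // G /shape_basis_Sh_to_Shstar FG.
  by apply: F0V; rewrite /shape_basis /= in F0F FG *; rewrite F0F.
(* The required open set is the union of the basic sets around [Sh_to_Shstar G] at level [a], over
   all [(G, a)] whose basic set lies in [U]. *)
pose N (i : Sh R Y X * idx p) := forall G, shape_basis I p i G -> U G.
exists (fun H => exists2 i, N i & shape_basis Istar p (Sh_to_Shstar i.1, i.2) H).
  move=> H [i Ni iH]; exists (Sh_to_Shstar i.1, i.2); split=> // K iK.
  by exists i.
move=> H; split=> [[F UF <-]|[[[G a] NG GH] [F FH]]].
  split; last by exists F.
  have [[G a] [GF GU]] := oU F UF.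
  by exists (G, a) => //; apply/shape_basis_Sh_to_Shstar.
exists F => //; apply: NG; apply/shape_basis_Sh_to_Shstar.
by rewrite FH.
Qed.

End ShapeToCoarseShape.

Theorem mainTheorem9 (R : realType) (X : ptopologicalType)
    (p : HPol_expansion R X) (k : nat) :
  topological_embedding (shape_pi_top k p) (coarse_shape_pi_top k p)
    (@J R k X).
Proof. exact: Sh_to_Shstar_embedding. Qed.
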